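(* Let $Q$ be a finite loop. Then $P(Q)\subseteq Q'$ if and only if there is no normal subloop $N$ of $Q$ such that $|N|$ is odd and $Q/N\cong\mathbb{Z}_{2^m}$ for some $m\geq 1$.
   Context: A loop is a set $Q$ with a binary operation and a neutral element $1$ such that for all $x,z\in Q$ the equations $x\cdot y_1=z$ and $y_2\cdot x=z$ have unique solutions $y_1,y_2\in Q$. Write $L_x(y)=xy$ and $R_x(y)=yx$. The inner mappings of $Q$ are $L(x,y)=L_{yx}^{-1}L_yL_x$, $R(x,y)=R_{xy}^{-1}R_yR_x$ and $T(x)=R_x^{-1}L_x$. A subloop is normal if it is invariant under all inner mappings. The derived subloop $Q'$ is the smallest normal subloop of $Q$ such that $Q/Q'$ is an Abelian group. $P(Q)$ is the set of elements of $Q$ that can be written as a product (in some order and with some association/bracketing) in which every element of $Q$ occurs as a factor precisely once. $\mathbb{Z}_{2^m}$ is the cyclic group of order $2^m$. *)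

(* Defs.v *)
From HB Require Import structures.
From mathcomp Require Import all_boot all_order all_fingroup all_algebra.

Set Implicit Arguments.
Unset Strict Implicit.
Unset Printing Implicit Defensive.

Declare Scope loop_scope.
Delimit Scope loop_scope with L.
Local Open Scope loop_scope.

(* Not built on the magmas of MathComp: a join of its unitary magmas with finite
   types would have had to be declared before its finite groups. *)
HB.mixin Record isLoop Q := {
  loop_mul : Q -> Q -> Q;
  loop_one : Q;
  loop_mul1x : left_id loop_one loop_mul;
  loop_mulx1 : right_id loop_one loop_mul;
  loop_ldivP : forall x z : Q, exists! y, loop_mul x y = z;
  loop_rdivP : forall x z : Q, exists! y, loop_mul y x = z
}.

#[short(type="loopType")]
HB.structure Definition Loop := {Q of isLoop Q}.

#[short(type="finLoopType")]
HB.structure Definition FinLoop := {Q of Loop Q & Finite Q}.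

Bind Scope loop_scope with Loop.sort FinLoop.sort.
Notation "x * y" := (loop_mul x y) : loop_scope.
Notation "1" := (@loop_one _) : loop_scope.

Lemma loop_mulI (Q : loopType) (x : Q) : injective (fun y => x * y).
Proof.
move=> y y' /= e; have [w [_ uw]] := loop_ldivP x (x * y').
by rewrite -(uw y e) -(uw y' erefl).
Qed.

Lemma loop_mulIr (Q : loopType) (x : Q) : injective (fun y => y * x).
Proof.
move=> y y' /= e; have [w [_ uw]] := loop_rdivP x (y' * x).
by rewrite -(uw y e) -(uw y' erefl).
Qed.

(* The translations, as permutations so that their inverses are at hand. *)
Definition ltrans (Q : finLoopType) (x : Q) : {perm Q} := perm (@loop_mulI Q x).
Definition rtrans (Q : finLoopType) (x : Q) : {perm Q} := perm (@loop_mulIr Q x).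

(* Inner mappings are compositions of functions applied from right to left,
   whereas the product of {perm Q} composes from left to right; hence they are
   written out pointwise. *)
Definition innerL (Q : finLoopType) (x y z : Q) : Q :=
  (ltrans (y * x))^-1%g (ltrans y (ltrans x z)).
Definition innerR (Q : finLoopType) (x y z : Q) : Q :=
  (rtrans (x * y))^-1%g (rtrans y (rtrans x z)).
Definition innerT (Q : finLoopType) (x z : Q) : Q :=
  (rtrans x)^-1%g (ltrans x z).

(* The last two clauses are closure under the two divisions: (ltrans x)^-1 y is
   x \ y and (rtrans x)^-1 y is y / x. *)
Definition is_subloop (Q : finLoopType) (N : {set Q}) : bool :=
  [&& 1 \in N,
      [forall x in N, forall y in N, x * y \in N],
      [forall x in N, forall y in N, (ltrans x)^-1%g y \in N] &
      [forall x in N, forall y in N, (rtrans x)^-1%g y \in N]].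

Definition inner_invariant (Q : finLoopType) (N : {set Q}) : bool :=
  [&& [forall x, forall y, innerL x y @: N == N],
      [forall x, forall y, innerR x y @: N == N] &
      [forall x, innerT x @: N == N]].

Definition is_normal_subloop (Q : finLoopType) (N : {set Q}) : bool :=
  is_subloop N && inner_invariant N.

Record normalSubloop (Q : finLoopType) := NormalSubloop {
  nsub_set :> {set Q};
  nsub_normal : is_normal_subloop nsub_set
}.

HB.instance Definition _ (Q : finLoopType) := [isSub for @nsub_set Q].
HB.instance Definition _ (Q : finLoopType) :=
  [Finite of normalSubloop Q by <:].

Section Cosets.

Variable Q : finLoopType.
Implicit Types (N : normalSubloop Q) (x y z n : Q).

Lemma ltransE x y : ltrans x y = x * y. Proof. by rewrite permE. Qed.
Lemma rtransE x y : rtrans x y = y * x. Proof. by rewrite permE. Qed.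
Lemma ltransVK x y : x * (ltrans x)^-1%g y = y.
Proof. by rewrite -ltransE permKV. Qed.
Lemma rtransVK x y : (rtrans x)^-1%g y * x = y.
Proof. by rewrite -rtransE permKV. Qed.

Definition lcos (A : {set Q}) x : {set Q} := [set x * n | n in A].

Lemma nsub1 N : 1 \in N.
Proof. by case/andP: (nsub_normal N) => /and4P[]. Qed.

Lemma nsubM N x y : x \in N -> y \in N -> x * y \in N.
Proof.
case/andP: (nsub_normal N) => /and4P[_ h _ _] _ xN yN.
by move/forall_inP: h => /(_ x xN)/forall_inP; apply.
Qed.

Lemma nsubLV N x y : x \in N -> y \in N -> (ltrans x)^-1%g y \in N.
Proof.
case/andP: (nsub_normal N) => /and4P[_ _ h _] _ xN yN.
by move/forall_inP: h => /(_ x xN)/forall_inP; apply.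
Qed.

Lemma nsub_innerL N x y : innerL x y @: N = N.
Proof.
by case/andP: (nsub_normal N) => _ /and3P[/forallP/(_ x)/forallP/(_ y)/eqP].
Qed.

Lemma nsub_innerR N x y : innerR x y @: N = N.
Proof.
by case/andP: (nsub_normal N) => _ /and3P[_ /forallP/(_ x)/forallP/(_ y)/eqP].
Qed.

Lemma nsub_innerT N x : innerT x @: N = N.
Proof. by case/andP: (nsub_normal N) => _ /and3P[_ _ /forallP/(_ x)/eqP]. Qed.

Lemma lcosP N x z : reflect (exists2 n, n \in N & z = x * n) (z \in lcos N x).
Proof. exact: imsetP. Qed.

Lemma lcos_innerL N x y n : n \in N ->
  exists2 n', n' \in N & y * (x * n) = (y * x) * n'.
Proof.
move=> nN; exists (innerL x y n); first by rewrite -(nsub_innerL N x y) imset_f.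
by rewrite /innerL ltransVK !ltransE.
Qed.

Lemma lcos_innerLV N x y n : n \in N ->
  exists2 n', n' \in N & (y * x) * n = y * (x * n').
Proof.
rewrite -{1}(nsub_innerL N x y) => /imsetP[n' n'N ->]; exists n' => //.
by rewrite /innerL ltransVK !ltransE.
Qed.

Lemma lcos_innerT N x n : n \in N -> exists2 n', n' \in N & x * n = n' * x.
Proof.
move=> nN; exists (innerT x n); first by rewrite -(nsub_innerT N x) imset_f.
by rewrite /innerT rtransVK ltransE.
Qed.

Lemma lcos_innerTV N x n : n \in N -> exists2 n', n' \in N & n * x = x * n'.
Proof.
rewrite -{1}(nsub_innerT N x) => /imsetP[n' n'N ->]; exists n' => //.
by rewrite /innerT rtransVK ltransE.
Qed.

Lemma lcos_innerR N x y n : n \in N ->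
  exists2 n', n' \in N & (n * x) * y = n' * (x * y).
Proof.
move=> nN; exists (innerR x y n); first by rewrite -(nsub_innerR N x y) imset_f.
by rewrite /innerR rtransVK !rtransE.
Qed.

Lemma lcos_refl N x : x \in lcos N x.
Proof. by apply/lcosP; exists 1; rewrite ?nsub1 ?loop_mulx1. Qed.

Lemma lcos_eq N x z : z \in lcos N x -> lcos N z = lcos N x.
Proof.
case/lcosP=> n nN ->; apply/setP=> w; apply/lcosP/lcosP=> -[k kN ->].
  have [k' k'N ->] := lcos_innerLV n x kN.
  by exists (n * k'); rewrite ?nsubM.
have lN := nsubLV nN kN; have [k' k'N e] := lcos_innerL n x lN.
by exists k' => //; rewrite -e ltransVK.
Qed.

Lemma lcosE N x y : (lcos N x == lcos N y) = (x \in lcos N y).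
Proof.
by apply/eqP/idP=> [<-|/lcos_eq//]; exact: lcos_refl.
Qed.

Lemma lcosM N x y :
  [set a * b | a in lcos N x, b in lcos N y] = lcos N (x * y).
Proof.
apply/setP=> w; apply/imset2P/lcosP=> [[a b]|[n nN ->]].
  case/lcosP=> n nN -> /lcosP[k kN ->] ->.
  have [k1 k1N ->] := lcos_innerL y (x * n) kN.
  have [n1 n1N ->] := lcos_innerT x nN.
  have [n2 n2N ->] := lcos_innerR x y n1N.
  have [n3 n3N ->] := lcos_innerTV (x * y) n2N.
  have [k2 k2N ->] := lcos_innerLV n3 (x * y) k1N.
  by exists (n3 * k2); rewrite ?nsubM.
have [n' n'N ->] := lcos_innerLV y x nN.
exists x (y * n') => //; first exact: lcos_refl.
by apply/lcosP; exists n'.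
Qed.

End Cosets.

(* The quotient Q / N: the left cosets x N under the elementwise product of
   sets, for which (x N) (y N) = (x y) N. *)
Definition is_coset (Q : finLoopType) (N : normalSubloop Q) (A : {set Q}) :=
  [exists x, A == lcos N x].

Record quotient_loop (Q : finLoopType) (N : normalSubloop Q) := QuotientLoop {
  quo_set :> {set Q};
  quo_coset : is_coset N quo_set
}.

HB.instance Definition _ (Q : finLoopType) (N : normalSubloop Q) :=
  [isSub for @quo_set Q N].
HB.instance Definition _ (Q : finLoopType) (N : normalSubloop Q) :=
  [Finite of quotient_loop N by <:].

Section Quotient.

Variables (Q : finLoopType) (N : normalSubloop Q).
Implicit Types (A B C : quotient_loop N).

Lemma is_coset_lcos (x : Q) : is_coset N (lcos N x).
Proof. by apply/existsP; exists x. Qed.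

Definition to_quo (x : Q) : quotient_loop N := QuotientLoop (is_coset_lcos x).

Lemma to_quoP A : exists x, A = to_quo x.
Proof.
by have /existsP[x /eqP e] := quo_coset A; exists x; apply/val_inj.
Qed.

Lemma quo_mul_coset A B : is_coset N [set a * b | a in quo_set A, b in quo_set B].
Proof.
have [x ->] := to_quoP A; have [y ->] := to_quoP B.
by rewrite lcosM is_coset_lcos.
Qed.

Definition quo_mul A B : quotient_loop N := QuotientLoop (quo_mul_coset A B).

Lemma to_quo_mul (x y : Q) : quo_mul (to_quo x) (to_quo y) = to_quo (x * y).
Proof. by apply/val_inj; rewrite /= lcosM. Qed.

Lemma to_quo_eq (x y : Q) : to_quo x = to_quo y <-> x \in lcos N y.
Proof.
split=> [/(congr1 val)/= e|/lcos_eq e]; last exact/val_inj.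
by rewrite -e lcos_refl.
Qed.

Lemma quo_mul1q : left_id (to_quo 1) quo_mul.
Proof. by move=> A; have [x ->] := to_quoP A; rewrite to_quo_mul loop_mul1x. Qed.

Lemma quo_mulq1 : right_id (to_quo 1) quo_mul.
Proof. by move=> A; have [x ->] := to_quoP A; rewrite to_quo_mul loop_mulx1. Qed.

Lemma quo_ldivP A C : exists! B, quo_mul A B = C.
Proof.
have [x ->] := to_quoP A; have [z ->] := to_quoP C.
exists (to_quo ((ltrans x)^-1%g z)); split.
  by rewrite to_quo_mul ltransVK.
move=> B; have [y ->] := to_quoP B; rewrite to_quo_mul => /to_quo_eq e.
apply/esym/to_quo_eq/lcosP.
case/lcosP: e => n nN; rewrite -{1}(ltransVK x z).
have [n' n'N ->] := lcos_innerLV ((ltrans x)^-1%g z) x nN.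
by move/loop_mulI => ->; exists n'.
Qed.

Lemma quo_rdivP A C : exists! B, quo_mul B A = C.
Proof.
have [x ->] := to_quoP A; have [z ->] := to_quoP C.
exists (to_quo ((rtrans x)^-1%g z)); split.
  by rewrite to_quo_mul rtransVK.
move=> B; have [y ->] := to_quoP B; rewrite to_quo_mul => /to_quo_eq e.
case/lcosP: e => n nN e; apply/to_quo_eq/lcosP.
set w := (rtrans x)^-1%g z.
have ez : z = w * x by rewrite rtransVK.
(* y x = (w x) n, and (w x) N = (w N) x *)
have [n1 n1N e1] := lcos_innerT (w * x) nN.
have : n1 \in innerR w x @: N by rewrite nsub_innerR.
case/imsetP=> n2 n2N en1.
have e2 : (n2 * w) * x = n1 * (w * x).
  by rewrite en1 /innerR rtransVK !rtransE.
move: e; rewrite ez e1 -e2 => /loop_mulIr ->.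
have [n3 n3N ->] := lcos_innerTV w n2N.
have : w \in lcos N (w * n3).
  by rewrite (_ : lcos N (w * n3) = lcos N w) ?lcos_refl //;
     apply/lcos_eq/lcosP; exists n3.
by case/lcosP=> n4 n4N e4; exists n4.
Qed.

HB.instance Definition _ :=
  isLoop.Build (quotient_loop N) quo_mul1q quo_mulq1 quo_ldivP quo_rdivP.

End Quotient.

Definition is_abelian_group (L : finLoopType) : bool :=
  [forall x : L, forall y : L, x * y == y * x] &&
  [forall x : L, forall y : L, forall z : L, x * (y * z) == x * y * z].

(* The smallest normal subloop with an Abelian group as quotient is the
   intersection of all of them, as derivedP below confirms. *)
Definition derived_set (Q : finLoopType) : {set Q} :=
  \bigcap_(N : normalSubloop Q | is_abelian_group (quotient_loop N)) N.

Section Derived.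

Variable Q : finLoopType.

Lemma innerL_inj (x y : Q) : injective (innerL x y).
Proof. by move=> z z' /perm_inj/perm_inj/perm_inj. Qed.
Lemma innerR_inj (x y : Q) : injective (innerR x y).
Proof. by move=> z z' /perm_inj/perm_inj/perm_inj. Qed.
Lemma innerT_inj (x : Q) : injective (innerT x).
Proof. by move=> z z' /perm_inj/perm_inj. Qed.

Lemma derived_setP (z : Q) :
  reflect (forall N : normalSubloop Q,
             is_abelian_group (quotient_loop N) -> z \in N)
          (z \in derived_set Q).
Proof. exact: bigcapP. Qed.

Lemma derived_invariant (f : Q -> Q) : injective f ->
  (forall N : normalSubloop Q, f @: N = N) ->
  f @: derived_set Q = derived_set Q.
Proof.
move=> fI fN; apply/eqP; rewrite eqEcard card_imset // leqnn andbT.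
apply/subsetP=> _ /imsetP[z /derived_setP zD ->]; apply/derived_setP=> N aN.
by rewrite -fN imset_f ?zD.
Qed.

Lemma derived_normal : is_normal_subloop (derived_set Q).
Proof.
apply/andP; split.
  apply/and4P; split; first by apply/derived_setP=> N _; exact: nsub1.
  - apply/forall_inP=> x /derived_setP xD; apply/forall_inP=> y /derived_setP yD.
    by apply/derived_setP=> N aN; rewrite nsubM ?xD ?yD.
  - apply/forall_inP=> x /derived_setP xD; apply/forall_inP=> y /derived_setP yD.
    by apply/derived_setP=> N aN; rewrite nsubLV ?xD ?yD.
  apply/forall_inP=> x /derived_setP xD; apply/forall_inP=> y /derived_setP yD.
  apply/derived_setP=> N aN; case/andP: (nsub_normal N) => /and4P[_ _ _ h] _.
  by move/forall_inP: h => /(_ x (xD N aN))/forall_inP; apply; apply: yD.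
apply/and3P; split.
- apply/forallP=> x; apply/forallP=> y; apply/eqP.
  by apply: derived_invariant=> [|N]; [exact: innerL_inj | exact: nsub_innerL].
- apply/forallP=> x; apply/forallP=> y; apply/eqP.
  by apply: derived_invariant=> [|N]; [exact: innerR_inj | exact: nsub_innerR].
apply/forallP=> x; apply/eqP.
by apply: derived_invariant=> [|N]; [exact: innerT_inj | exact: nsub_innerT].
Qed.

Definition derived_subloop : normalSubloop Q := NormalSubloop derived_normal.

Lemma derivedP :
  is_abelian_group (quotient_loop derived_subloop) /\
  forall N : normalSubloop Q,
    is_abelian_group (quotient_loop N) -> derived_subloop \subset N.
Proof.
split=> [|N aN]; last by apply/subsetP=> z /derived_setP; apply.
have key (x y : Q) :
    (forall N : normalSubloop Q, is_abelian_group (quotient_loop N) ->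
       to_quo N x = to_quo N y) ->
    to_quo derived_subloop x = to_quo derived_subloop y.
  move=> h; apply/to_quo_eq/lcosP; exists ((ltrans y)^-1%g x).
    apply/derived_setP=> N aN.
    have /to_quo_eq/lcosP[n nN ->] := h N aN.
    by rewrite -ltransE permK.
  by rewrite ltransVK.
have qM N (x y : Q) : to_quo N x * to_quo N y = to_quo N (x * y).
  exact: to_quo_mul.
apply/andP; split.
  apply/forallP=> A; apply/forallP=> B; apply/eqP.
  have [x ->] := to_quoP A; have [y ->] := to_quoP B.
  rewrite !qM; apply: key => N /andP[/forallP/(_ (to_quo N x))].
  by move/forallP/(_ (to_quo N y))/eqP; rewrite !qM.
apply/forallP=> A; apply/forallP=> B; apply/forallP=> C; apply/eqP.
have [x ->] := to_quoP A; have [y ->] := to_quoP B; have [z ->] := to_quoP C.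
rewrite !qM; apply: key => N /andP[_ /forallP/(_ (to_quo N x))].
by move/forallP/(_ (to_quo N y))/forallP/(_ (to_quo N z))/eqP; rewrite !qM.
Qed.

End Derived.

Arguments derived_subloop : clear implicits.

(* A bracketed product: a binary tree whose leaves are the factors. *)
Inductive bracketing (T : Type) :=
  | Factor of T
  | Bracket of bracketing T & bracketing T.

Fixpoint factors (T : Type) (t : bracketing T) : seq T :=
  match t with
  | Factor x => [:: x]
  | Bracket l r => factors l ++ factors r
  end.

Fixpoint bracket_value (Q : loopType) (t : bracketing Q) : Q :=
  match t with
  | Factor x => x
  | Bracket l r => bracket_value l * bracket_value r
  end.

(* Membership in P(Q). *)
Definition full_product (Q : finLoopType) (a : Q) : Prop :=
  exists t : bracketing Q,
    (forall x : Q, count_mem x (factors t) = 1%N) /\ bracket_value t = a.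

(* 'Z_n is the additive group of integers modulo n only for n > 1. *)
Definition isomorphic_to_Z (L : loopType) (n : nat) : Prop :=
  exists f : L -> 'Z_n,
    bijective f /\ {morph f : x y / (x * y)%L >-> (x + y)%R}.

(* Main.v *)
From HB Require Import structures.
Require Import Defs.
From mathcomp Require Import all_boot all_order all_fingroup all_algebra.
From mathcomp Require Import all_solvable.

(* The image in the abelian group A = Q/Q' of any full product is the sum of the
   classes of all elements of Q, that is |Q'| s with s the sum of all elements
   of A. Pairing x with -x gives 2 s = 0, so full products leave Q' exactly when
   |Q'| is odd and s is nonzero. If s is nonzero, s is the only involution of A:
   only elements killed by 2 contribute to s, and for an involution u pairing x
   with x + u makes s a multiple of u. The Sylow 2-subgroup of A is then cyclic,
   and the kernel of the projection of Q onto it is the required N. Conversely,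
   modulo such an N a full product becomes the sum of all elements of Z_(2^m),
   which is nonzero. *)

Set Implicit Arguments.
Unset Strict Implicit.
Unset Printing Implicit Defensive.

Import GRing.Theory.

(** * Existence of full products *)

Lemma bracketing_of_seq (T : Type) (x : T) (s : seq T) :
  exists t : bracketing T, factors t = x :: s.
Proof.
elim: s x => [|y s IHs] x; first by exists (Factor x).
by have [t et] := IHs y; exists (Bracket (Factor x) t); rewrite /= et.
Qed.

(** Keeps the inclusion of P(Q) in Q' from being vacuous: an enumeration of [Q] is bracketed to the
    right. *)
Lemma full_product_exists (Q : finLoopType) : exists a : Q, full_product a.
Proof.
have: 1%L \in enum Q by rewrite mem_enum.
case eQ: (enum Q) => [//|x s] _.
have [t et] := bracketing_of_seq x s.
exists (bracket_value t), t; split=> // y.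
by rewrite et -eQ count_uniq_mem ?enum_uniq // mem_enum.
Qed.

(** * Loop homomorphisms into an abelian group *)

Section AdditiveMorphism.

Context {Q : finLoopType} {V : zmodType}.
Variable h : Q -> V.
Hypothesis hM : {morph h : x y / (x * y)%L >-> (x + y)%R}.

Local Open Scope ring_scope.

Lemma lmorph1 : h 1%L = 0.
Proof. by apply: (@addrI _ (h 1%L)); rewrite -hM loop_mulx1 addr0. Qed.

Lemma lmorph_ldiv x y : h ((ltrans x)^-1%g y) = h y - h x.
Proof. by rewrite -{2}(ltransVK x y) hM addrAC subrr add0r. Qed.

Lemma lmorph_rdiv x y : h ((rtrans x)^-1%g y) = h y - h x.
Proof. by rewrite -{2}(rtransVK x y) hM addrK. Qed.

Definition lmorph_ker : {set Q} := [set x | h x == 0].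

Lemma lmorph_ker_normal : is_normal_subloop lmorph_ker.
Proof.
(* An injective map sending the finite kernel into itself maps it onto itself. *)
have inner_stable (f : Q -> Q) : injective f -> (forall z, h (f z) = h z) ->
    f @: lmorph_ker = lmorph_ker.
  move=> fI hf; apply/eqP; rewrite eqEcard card_imset // leqnn andbT.
  by apply/subsetP=> _ /imsetP[z zK ->]; rewrite inE hf; rewrite inE in zK.
apply/andP; split.
  apply/and4P; split; first by rewrite inE lmorph1.
  - apply/forall_inP=> x /[!inE]/eqP hx; apply/forall_inP=> y /[!inE]/eqP hy.
    by rewrite hM hx hy addr0.
  - apply/forall_inP=> x /[!inE]/eqP hx; apply/forall_inP=> y /[!inE]/eqP hy.
    by rewrite lmorph_ldiv hx hy subr0.
  apply/forall_inP=> x /[!inE]/eqP hx; apply/forall_inP=> y /[!inE]/eqP hy.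
  by rewrite lmorph_rdiv hx hy subr0.
apply/and3P; split.
- apply/forallP=> x; apply/forallP=> y; apply/eqP.
  apply: inner_stable => [|z]; first exact: innerL_inj.
  by rewrite /innerL lmorph_ldiv !ltransE !hM addrA [LHS]addrAC subrr add0r.
- apply/forallP=> x; apply/forallP=> y; apply/eqP.
  apply: inner_stable => [|z]; first exact: innerR_inj.
  by rewrite /innerR lmorph_rdiv !rtransE !hM -[h z + _ + _]addrA addrK.
apply/forallP=> x; apply/eqP.
apply: inner_stable => [|z]; first exact: innerT_inj.
by rewrite /innerT lmorph_rdiv ltransE hM addrAC subrr add0r.
Qed.

Definition lmorph_kernel : normalSubloop Q := NormalSubloop lmorph_ker_normal.

Lemma lmorph_bracket_value (t : bracketing Q) :
  h (bracket_value t) = \sum_(x <- factors t) h x.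
Proof.
elim: t => [x|l IHl r IHr] /=; first by rewrite big_seq1.
by rewrite hM IHl IHr big_cat.
Qed.

(** In an abelian group neither the order nor the bracketing of the factors matters. *)
Lemma lmorph_full_product a : full_product a -> h a = \sum_x h x.
Proof.
case=> t [t1 <-]; rewrite lmorph_bracket_value; apply: perm_big.
by apply/allP=> x _ /=; rewrite t1 count_uniq_mem ?index_enum_uniq // mem_index_enum.
Qed.

(** Left translation by [y] carries the kernel bijectively onto the fibre through [y]. *)
Lemma card_lmorph_fibre y : #|[set x | h x == h y]| = #|lmorph_ker|.
Proof.
rewrite -[RHS](card_imset _ (@loop_mulI Q y)); apply/esym/eq_card => x.
apply/imsetP/idP=> [[z /[!inE]/eqP hz ->]|/[!inE]/eqP exy].
  by rewrite hM hz addr0.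
exists ((ltrans y)^-1%g x); last by rewrite ltransVK.
by rewrite inE lmorph_ldiv exy subrr.
Qed.

Lemma lmorph_eq_to_quo x y :
  to_quo lmorph_kernel x = to_quo lmorph_kernel y <-> h x = h y.
Proof.
split=> [/to_quo_eq/lcosP[n]|exy].
  by rewrite inE => /eqP hn ->; rewrite hM hn addr0.
apply/to_quo_eq/lcosP; exists ((ltrans y)^-1%g x); last by rewrite ltransVK.
by rewrite inE lmorph_ldiv exy subrr.
Qed.

End AdditiveMorphism.

(** * Surjective homomorphisms: counting and first isomorphism *)

Section SurjectiveMorphism.

Context {Q : finLoopType} {V : finZmodType}.
Variable h : Q -> V.
Hypothesis hM : {morph h : x y / (x * y)%L >-> (x + y)%R}.
Hypothesis hS : forall v, exists x, h x = v.

Local Open Scope ring_scope.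

Lemma sum_lmorph : \sum_x h x = (\sum_(v : V) v) *+ #|lmorph_ker h|.
Proof.
rewrite (partition_big h predT) //= -sumrMnl; apply: eq_bigr => v _.
have [y <-] := hS v; rewrite -(card_lmorph_fibre hM y) -sumr_const.
by apply: eq_big => x; [rewrite inE | move/eqP].
Qed.

Lemma card_lmorph : #|Q| = (#|V| * #|lmorph_ker h|)%N.
Proof.
rewrite -[LHS]sum1_card (partition_big h predT) //= -sum_nat_const.
apply: eq_bigr => v _; have [y <-] := hS v.
by rewrite -(card_lmorph_fibre hM y) -sum1_card; apply: eq_bigl => x; rewrite inE.
Qed.

Lemma lmorph_first_isom :
  exists f : quotient_loop (lmorph_kernel hM) -> V,
    bijective f /\ {morph f : x y / (x * y)%L >-> (x + y)}.
Proof.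
pose N := lmorph_kernel hM.
have reprP (A : quotient_loop N) : exists x, A == to_quo N x.
  by have [x ->] := to_quoP A; exists x.
pose f A := h (xchoose (reprP A)).
(* Any representative serves, since the classes modulo the kernel are the fibres of [h]. *)
have fE x : f (to_quo N x) = h x.
  by apply/(lmorph_eq_to_quo hM)/esym/eqP/(xchooseP (reprP (to_quo N x))).
have secP v : exists x, h x == v by have [x <-] := hS v; exists x.
exists f; split; last first.
  move=> A B; have [x ->] := to_quoP A; have [y ->] := to_quoP B.
  by rewrite [(_ * _)%L]to_quo_mul !fE hM.
exists (fun v => to_quo N (xchoose (secP v))) => [A|v].
  have [x ->] := to_quoP A; apply/(lmorph_eq_to_quo hM).
  by rewrite fE (eqP (xchooseP (secP (h x)))).
by rewrite fE (eqP (xchooseP (secP v))).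
Qed.

End SurjectiveMorphism.

(** * The sum of all elements of a finite abelian group *)

Section SumOfAllElements.

Variable V : finZmodType.
Local Open Scope ring_scope.

Let s : V := \sum_(v : V) v.

(* Breaking the symmetry of an involution without fixed points: one half of the
   sum runs over the x preceding f x in the enumeration, the other over f x. *)
Lemma sum_fixfree_involution (P : pred V) (f : V -> V) :
    involutive f -> (forall x, P x -> P (f x)) -> (forall x, P x -> f x != x) ->
  \sum_(x | P x) x =
  \sum_(x | P x && (enum_rank x < enum_rank (f x))%N) (x + f x).
Proof.
move=> fK Pf ff; have PfE x : P (f x) = P x.
  by apply/idP/idP=> /Pf //; rewrite fK.
rewrite (bigID (fun x => (enum_rank x < enum_rank (f x))%N)) big_split /=.
congr (_ + _); rewrite (reindex_inj (inv_inj fK)) /=; apply: eq_bigl => x.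
(* The complementary half is again given by a strict inequality: [f] has no fixed point in [P], so
   ranks never tie. *)
rewrite PfE fK; case Px: (P x) => //=; rewrite -leqNgt leq_eqVlt orbC.
case: ltnP => //= _; apply/negbTE; rewrite val_eqE (inj_eq enum_rank_inj).
by rewrite eq_sym ff.
Qed.

Lemma sum_all_involutions : s = \sum_(v : V | v + v == 0) v.
Proof.
rewrite /s (bigID (fun v : V => v + v == 0)) /= [X in _ + X](_ : _ = 0) ?addr0 //.
rewrite (@sum_fixfree_involution _ -%R) => [|x|x|x].
- by apply: big1 => x _; rewrite subrr.
- exact: opprK.
- by rewrite -opprD oppr_eq0.
by apply: contra => /eqP ex; rewrite -{1}ex addNr.
Qed.

Lemma double_sum_all : s + s = 0.
Proof. by rewrite {1}/s (reindex_inj (@oppr_inj V)) /= sumrN addNr. Qed.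

Lemma sum_all_unique_involution u : s != 0 -> u != 0 -> u + u = 0 -> u = s.
Proof.
move=> s0 u0 uu.
have [k sk] : exists k, s = u *+ k.
  (* Each pair contributes x + (x + u) = u, as x is killed by 2; [k] counts the pairs. *)
  rewrite sum_all_involutions (@sum_fixfree_involution _ (fun x => x + u)).
  - rewrite (eq_bigr (fun=> u)); first by rewrite sumr_const; eexists.
    by move=> x /andP[/eqP xx _]; rewrite addrA xx add0r.
  - by move=> x; rewrite -addrA uu addr0.
  - by move=> x /eqP xx; rewrite addrACA xx uu addr0.
  by move=> x _; rewrite -subr_eq0 addrAC subrr add0r.
(* As 2u = 0, only the parity of [k] matters, and [s] nonzero forces it to be odd. *)
move: s0; rewrite sk -(odd_double_half k) mulrnDr -mul2n mulrnA [u *+ 2]uu mul0rn.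
by rewrite addr0; case: odd; rewrite ?eqxx.
Qed.

(** Since [s] is the only involution, ['Ohm_1] of the 2-part lies in the group of order 2 generated
    by [s]; an abelian 2-group of rank at most 1 is cyclic. *)
Lemma sum_all_cyclic_sylow : s != 0 ->
  cyclic 'O_2([set: V])%g /\ (2 %| #|V|)%N.
Proof.
move=> s0; have abV : abelian [set: V] := FinRing.zmod_abelian _.
have S2 : (2.-group 'O_2([set: V]))%g := pcore_pgroup _ _.
have abS : abelian 'O_2([set: V])%g := abelianS (pcore_sub _ _) abV.
have os : #[s]%g = 2%N.
  apply: nt_prime_order => //.
  by rewrite FinRing.zmodXgE mulr2n double_sum_all.
split; last by rewrite -os -cardsT order_dvdG ?inE.
rewrite abelian_rank1_cyclic // (rank_pgroup S2) p_rank_abelian //.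
(* The bound 1 becomes the 2-logarithm of 2, so it suffices that the order of ['Ohm_1] divides
   [#[s]]. *)
rewrite -[leqRHS](pfactorK 1 (isT : prime 2)) dvdn_leq_log //.
have eS : (2.-abelem 'Ohm_1('O_2([set: V])))%g := Ohm1_abelem S2 abS.
rewrite expn1 -[X in (_ %| X)%N]os cardSg //.
apply/subsetP=> u uS; have [->|u1] := eqVneq u 1%g.
  exact: group1.
rewrite (_ : u = s) ?cycle_id //; apply: sum_all_unique_involution => //.
by rewrite -mulr2n -FinRing.zmodXgE -(abelem_order_p eS uS u1) expg_order.
Qed.

(** The 2-constituent of an element is a power of the generator [a]; [g] reads off its exponent by
    inverting [Zpm]. *)
Lemma cyclic_sylow_morphism : cyclic 'O_2([set: V])%g -> (2 %| #|V|)%N ->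
  exists g : V -> 'Z_(2 ^ logn 2 #|V|),
    {morph g : x y / x + y} /\ (forall z, exists v, g v = z).
Proof.
move=> /cyclicP[a ea] V2; have abV : abelian [set: V] := FinRing.zmod_abelian _.
have HS := nilpotent_pcore_Hall 2%N (abelian_nil abV).
have oa : #[a]%g = (2 ^ logn 2 #|V|)%N.
  by rewrite /order -ea (card_Hall HS) cardsT p_part.
have m0 : (0 < logn 2 #|V|)%N by rewrite -pfactor_dvdn // -cardsT cardG_gt0.
rewrite -oa.
(* [Zp #[a]] is all of ['Z_#[a]] only when [1 < #[a]], which the evenness of |V| ensures. *)
have a1 : (1 < #[a]%g)%N by rewrite oa -{1}(expn0 2) ltn_exp2l.
have constt_a v : (v.`_2)%g \in (Zpm @* Zp #[a])%g.
  by rewrite im_Zpm -ea (mem_Hall_pcore HS) ?inE ?p_elt_constt.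
exists (fun v => invm (injm_Zpm a) (v.`_2)%g); split=> [x y|z].
  rewrite -FinRing.zmodMgE consttM; last by apply: (centsP abV); rewrite inE.
  by rewrite morphM.
have zZ : z \in Zp #[a]%g by rewrite /Zp a1 inE.
exists (Zpm z); rewrite constt_p_elt ?invmE //.
have zS : Zpm z \in 'O_2([set: V])%g by rewrite ea -im_Zpm mem_morphim.
exact: mem_p_elt (pcore_pgroup 2%N [set: V]%G) zS.
Qed.

End SumOfAllElements.

(** An alias of [L] indexed by the proof [abL], on which the additive group structure depends. *)
Definition abelian_loop (L : finLoopType) of is_abelian_group L : Type := L.

Section AbelianLoop.

Variables (L : finLoopType) (abL : is_abelian_group L).
Local Notation A := (abelian_loop abL).

HB.instance Definition _ := Finite.copy A L.

Let opp (x : A) : A := (rtrans (x : L))^-1%g 1%L.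

Let mulA : associative (fun x y : A => x * y)%L.
Proof.
by move=> x y z; case/andP: abL => _ /forallP/(_ x)/forallP/(_ y)/forallP/(_ z)/eqP.
Qed.

Let mulC : commutative (fun x y : A => x * y)%L.
Proof. by move=> x y; case/andP: abL => /forallP/(_ x)/forallP/(_ y)/eqP. Qed.

Let mulV : left_inverse (1%L : A) opp (fun x y : A => x * y)%L.
Proof. by move=> x; exact: rtransVK. Qed.

HB.instance Definition _ :=
  GRing.isZmodule.Build A mulA mulC (@loop_mul1x L) mulV.

End AbelianLoop.

(** The sum 0 + ... + (2n - 1) is n(2n - 1), an odd multiple of n, hence not divisible by 2n. *)
Lemma sum_Zn n : (0 < n)%N -> (\sum_(z : 'Z_n.*2) z != 0)%R.
Proof.
move=> n0; have n1 : (1 < n.*2)%N.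
  by rewrite -addnn; case: n n0 => // k _; rewrite addSn addnS.
rewrite (eq_bigr (fun z : 'Z_n.*2 => (z : nat)%:R%R)) => [|z _]; last first.
  by rewrite natr_Zp.
rewrite -natr_sum -(big_mkord xpredT id) Zp_cast // bin2_sum.
apply/eqP=> /(congr1 val); rewrite /= val_Zp_nat //.
rewrite bin2 -doubleMl doubleK => /eqP.
rewrite -/(dvdn _ _) -muln2 dvdn_pmul2l // dvdn2.
by case: n n0 {n1} => // k _; rewrite muln2 doubleS /= odd_double.
Qed.

Theorem theorem6 (Q : finLoopType) :
  (forall a : Q, full_product a -> a \in derived_subloop Q) <->
  ~ (exists N : normalSubloop Q,
       odd #|N| /\
       exists m : nat, 1 <= m /\ isomorphic_to_Z (quotient_loop N) (2 ^ m)).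
Proof.
have qM N (x y : Q) : (to_quo N x * to_quo N y)%L = to_quo N (x * y)%L.
  exact: to_quo_mul.
have ker_quo (N : normalSubloop Q) x : (x \in N) = (to_quo N x == to_quo N 1%L).
  apply/idP/eqP=> [xN|/to_quo_eq/lcosP[n nN ->]]; last by rewrite loop_mul1x.
  by apply/to_quo_eq/lcosP; exists x; rewrite ?loop_mul1x.
split=> [PQ [N [oddN [m [m0 [f [fB fM]]]]]]|noN a Pa].
  have [g gK fK] := fB.
  have fI := bij_inj fB.
  have abN : is_abelian_group (quotient_loop N).
    apply/andP; split.
      apply/forallP=> x; apply/forallP=> y; apply/eqP/fI.
      by rewrite !fM addrC.
    apply/forallP=> x; apply/forallP=> y; apply/forallP=> z; apply/eqP/fI.
    by rewrite !fM addrA.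
  have [a Pa] := full_product_exists Q.
  (* As Q/N is an abelian group, Q' lies in [N], and so does the full product [a]. *)
  have /eqP aN : to_quo N a == to_quo N 1%L.
    by rewrite -ker_quo (subsetP ((Defs.derivedP Q).2 N abN)) ?PQ.
  pose h x := f (to_quo N x).
  have hM : {morph h : x y / (x * y)%L >-> (x + y)%R}.
    by move=> x y; rewrite /h -qM fM.
  have hS v : exists x, h x = v.
    by have [x ex] := to_quoP (g v); exists x; rewrite /h -ex fK.
  have kerN : lmorph_ker h = N.
    by apply/setP=> x; rewrite inE -(lmorph1 hM) /h (inj_eq fI) ker_quo.
  (* Now 0 = h(a) = |N| s with s the sum of ['Z_(2 ^ m)]; |N| odd and 2s = 0 give s = 0, against
     [sum_Zn]. *)
  have := lmorph_full_product hM Pa; rewrite {1}/h aN -/(h _) (lmorph1 hM).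
  rewrite (sum_lmorph hM hS) kerN -(odd_double_half #|N|) oddN mulrnDr -mul2n.
  rewrite mulrnA mulr2n double_sum_all mul0rn addr0 => /esym/eqP; apply/negP.
  case: m m0 {f fB fM g gK fK fI h hM hS kerN} => // m _.
  by rewrite expnS mul2n sum_Zn ?expn_gt0.
apply/negPn/negP=> aQ'; apply: noN.
have [abQ _] := Defs.derivedP Q.
pose h (x : Q) : abelian_loop abQ := to_quo (derived_subloop Q) x.
have hM : {morph h : x y / (x * y)%L >-> (x + y)%R} by move=> x y; rewrite /h -qM.
have hS v : exists x, h x = v by have [x ->] := to_quoP v; exists x.
have kerQ' : lmorph_ker h = derived_subloop Q.
  by apply/setP=> x; rewrite inE -(lmorph1 hM) ker_quo.
have ha : h a != 0%R by rewrite -(lmorph1 hM) -ker_quo.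
move: ha; rewrite (lmorph_full_product hM Pa) (sum_lmorph hM hS).
rewrite -(odd_double_half #|_|) mulrnDr -mul2n.
rewrite mulrnA mulr2n double_sum_all mul0rn addr0.
(* For |Q'| even, h(a) = |Q'| s would vanish, although [a] lies outside Q'. *)
have [oQ'|_] := boolP (odd _); last by rewrite eqxx.
case/sum_all_cyclic_sylow=> cS V2.
have [g [gM gS]] := cyclic_sylow_morphism cS V2.
set m := logn 2 _ in g gM gS.
have m0 : (0 < m)%N by rewrite -pfactor_dvdn //; apply/card_gt0P; exists 0%R.
have ghM : {morph g \o h : x y / (x * y)%L >-> (x + y)%R}.
  by move=> x y; rewrite /= hM gM.
have ghS z : exists x, (g \o h) x = z.
  by have [v <-] := gS z; have [x <-] := hS v; exists x.
exists (lmorph_kernel ghM); split; last first.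
  by exists m; split=> //; exact: lmorph_first_isom.
have Q'0 : (0 < #|lmorph_ker h|)%N by rewrite kerQ' (cardD1 1%L) nsub1.
have N0 : (0 < #|lmorph_kernel ghM|)%N by rewrite (cardD1 1%L) nsub1.
have V0 : (0 < #|{: abelian_loop abQ}|)%N by apply/card_gt0P; exists 0%R.
have logn_odd k : (0 < k)%N -> odd k = (logn 2 k == 0).
  move=> k0; rewrite -[odd k]negbK -dvdn2 -{1}(expn1 2) pfactor_dvdn //.
  by rewrite -eqn0Ngt.
have cZ : #|'Z_(2 ^ m)| = (2 ^ m)%N.
  by rewrite card_ord Zp_cast // -{1}(expn0 2) ltn_exp2l.
(* Comparing 2-adic valuations in 2^m |N| = |Q| = |Q/Q'| |Q'|, where 2^m is the 2-part of |Q/Q'|,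
   shows |N| odd because |Q'| is. *)
have := congr1 (logn 2) (card_lmorph ghM ghS).
rewrite (card_lmorph hM hS) cZ !lognM ?expn_gt0 // pfactorK // -/m => /addnI; rewrite kerQ' => eN.
by rewrite logn_odd // -eN -logn_odd // -kerQ'.
Qed.
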